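(* Let $\mathcal{G}$ be a compact group acting continuously on a sample space $\mathcal{Y}$, and let $\varepsilon : \mathcal{Y} \to [0,\infty]$ be measurable. Then: (i) $\varepsilon$ is a valid e-value for $\mathcal{G}$ invariance if and only if $\mathbb{E}^{\mathrm{Unif}(O)}[\varepsilon] \leq 1$ for every orbit $O \in \mathcal{Y}/\mathcal{G}$; (ii) $\varepsilon$ is an exact e-value for $\mathcal{G}$ invariance if and only if $\mathbb{E}^{\mathrm{Unif}(O)}[\varepsilon] = 1$ for every orbit $O \in \mathcal{Y}/\mathcal{G}$.
   Context: All spaces are second-countable locally compact Hausdorff, equipped with their Borel $\sigma$-algebras. The orbit of $y$ is $O_y = \{Gy : G \in \mathcal{G}\}$, and $\mathcal{Y}/\mathcal{G}$ is the set of orbits. $\overline{G} \sim \mathrm{Unif}(\mathcal{G})$ denotes a random element distributed according to the Haar probability measure on $\mathcal{G}$. For an orbit $O$, $\mathrm{Unif}(O)$ is the unique $\mathcal{G}$ invariant probability on $O$, i.e. the law of $\overline{G}y$ for any $y \in O$. A probability measure $\mathbb{P}$ on $\mathcal{Y}$ is $\mathcal{G}$ invariant if $\mathbb{P}(G^{-1}A) = \mathbb{P}(A)$ for all $G \in \mathcal{G}$ and all events $A$. An e-value $\varepsilon$ is valid for $\mathcal{G}$ invariance if $\mathbb{E}^{\mathbb{P}}[\varepsilon] \leq 1$ for every $\mathcal{G}$ invariant probability $\mathbb{P}$ on $\mathcal{Y}$; it is exact for $\mathcal{G}$ invariance if $\mathbb{E}^{\mathbb{P}}[\varepsilon] = 1$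 for every $\mathcal{G}$ invariant probability $\mathbb{P}$. *)

(* Defs.v *)
From HB Require Import structures.
From mathcomp Require Import all_boot all_order all_algebra.
From mathcomp Require Import all_classical all_reals all_analysis measurable_realfun.

Set Implicit Arguments.
Unset Strict Implicit.
Unset Printing Implicit Defensive.

Import Order.TTheory GRing.Theory Num.Theory.

Local Open Scope classical_set_scope.
Local Open Scope ring_scope.
Local Open Scope ereal_scope.

(** Measurable spaces are pointed in the library,
    so the topological spaces below are pointed too: a group always is, and
    for a sample space this only says that it is nonempty. *)

Notation borel T := (g_sigma_algebraType (@open T)).

Definition lcscH (T : topologicalType) : Prop :=
  [/\ @second_countable T, locally_compact [set: T] & hausdorff_space T].

HB.mixin Record isTopologicalGroup G & PointedTopological G & monoid.Group G := {
  mulg_continuous : continuous (fun p : G * G => (p.1 * p.2)%g) ;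
  invg_continuous : continuous (fun g : G => g^-1%g)
}.

#[short(type="topGroupType")]
HB.structure Definition TopologicalGroup :=
  {G of PointedTopological G & monoid.Group G & isTopologicalGroup G}.

(** Left invariance suffices: on a compact group a left invariant Borel
    probability is unique and also right invariant, and regularity is automatic
    under second countability. *)
Definition is_haar (R : realType) (G : topGroupType)
    (mu : probability (borel G) R) : Prop :=
  forall (g : G) (A : set (borel G)), measurable A ->
    mu ((fun h : G => (g * h)%g) @^-1` A) = mu A.

Record continuousAction (G : topGroupType) (Y : ptopologicalType) := {
  act :> G -> Y -> Y ;
  act1 : forall y, act 1%g y = y ;
  actM : forall g h y, act (g * h)%g y = act g (act h y) ;
  act_continuous : continuous (fun p : G * Y => act p.1 p.2)
}.

Section action.
Context (G : topGroupType) (Y : ptopologicalType) (a : continuousAction G Y).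

Definition act_orbit (y : Y) : set Y := [set a g y | g in [set: G]].

Definition act_orbits : set (set Y) := range act_orbit.

Definition orbit_map (y : Y) (g : borel G) : borel Y := a g y.

Lemma orbit_map_continuous (y : Y) : continuous (fun g : G => a g y).
Proof.
move=> g.
have pairC : (h, y) @[h --> g] --> (g, y).
  by apply: cvg_pair; [exact: cvg_id|exact: cvg_cst].
have actC := @act_continuous _ _ a (g, y).
exact: (cvg_comp _ _ pairC actC).
Qed.

Lemma measurable_orbit_map (y : Y) : measurable_fun setT (orbit_map y).
Proof.
apply: (@measurability _ _ (borel G) (borel Y) setT _ (@open Y)) => //.
move=> _ [U oU <-]; rewrite setTI; apply: sub_sigma_algebra.
by have /continuousP := @orbit_map_continuous y; apply.
Qed.

HB.instance Definition _ (y : Y) :=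
  isMeasurableFun.Build _ _ _ _ (orbit_map y) (measurable_orbit_map y).

End action.

(** The law of [Gbar y], for [Gbar] with law [mu] and a chosen [y] in [O];
    it is meant for [O] an orbit and [mu] a Haar probability, in which case
    the choice of [y] is immaterial. *)
Definition unif (R : realType) (G : topGroupType) (Y : ptopologicalType)
    (mu : probability (borel G) R) (a : continuousAction G Y) (O : set Y) :
    probability (borel Y) R :=
  distribution mu (orbit_map a (xget point O)).

Definition invariant_probability (R : realType) (G : topGroupType)
    (Y : ptopologicalType) (a : continuousAction G Y)
    (P : probability (borel Y) R) : Prop :=
  forall (g : G) (A : set (borel Y)), measurable A -> P (a g @^-1` A) = P A.

Definition valid_evalue (R : realType) (G : topGroupType) (Y : ptopologicalType)
    (a : continuousAction G Y) (eps : borel Y -> \bar R) : Prop :=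
  forall P : probability (borel Y) R, invariant_probability a P ->
    \int[P]_y eps y <= 1.

Definition exact_evalue (R : realType) (G : topGroupType) (Y : ptopologicalType)
    (a : continuousAction G Y) (eps : borel Y -> \bar R) : Prop :=
  forall P : probability (borel Y) R, invariant_probability a P ->
    \int[P]_y eps y = 1.

(* Main.v *)
Require Import Defs.
From HB Require Import structures.
From mathcomp Require Import all_boot all_order all_algebra.
From mathcomp Require Import all_classical all_reals all_analysis measurable_realfun.

Set Implicit Arguments.
Unset Strict Implicit.
Unset Printing Implicit Defensive.

Local Open Scope classical_set_scope.
Local Open Scope ring_scope.
Local Open Scope ereal_scope.

(** The law of [Gbar y] is invariant because Haar measure is left invariant, so
    a bound or an equality that holds for every invariant probability holds for
    the uniform law on every orbit ([unif_invariant]).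

    Conversely, an invariant probability [P] is a mixture of the uniform laws on
    the orbits: replacing [y] by [a g y] does not change a [P]-integral,
    whatever [g], so averaging over a Haar distributed [g] does not either, and
    Tonelli's theorem exchanges the two integrals ([integral_average]):
    [E^P eps = E_(y ~ P) E_(g ~ haar) eps (a g y)].  The inner expectation is
    the one under the uniform law on the orbit of [y]; it is at most [1], or
    equal to [1], by hypothesis.

    Two points need care.  Tonelli's theorem asks for joint measurability with
    respect to the product of the two Borel sigma-algebras, whereas continuity
    of the action only gives it for the Borel sigma-algebra of the product
    space; second countability makes the two coincide ([measurable_open_prod]).
    And [unif] is the law of [Gbar y'] for a chosen point [y'] of the orbit of
    [y], so identifying it with the law of [Gbar y] requires Haar measure to be
    right invariant ([haar_integral_mulr]).  This follows from left invariance
    by the same averaging argument applied to the group itself, which shows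
    that Haar measure is invariant under inversion ([haar_integral_inv]). *)

(** * Borel measurability on products *)

(** In second-countable spaces, an open set of the product is the union of the
    rectangles of basic open sets that it contains, and there are only countably
    many of these. *)
Lemma measurable_open_prod (S T : ptopologicalType) (W : set (S * T)) :
  @second_countable S -> @second_countable T -> open W ->
  @measurable _ (borel S * borel T)%type W.
Proof.
move=> [BS cBS [oBS bBS]] [BT cBT [oBT bBT]] oW.
pose D := (BS `*` BT) `&` [set p | p.1 `*` p.2 `<=` W].
have cD : countable D.
  exact: sub_countable (subset_card_le (@subIsetl _ _ _)) (countableX cBS cBT).
have -> : W = \bigcup_(p in D) (p.1 `*` p.2).
  rewrite eqEsubset; split; last by move=> z [p [_ pW] /pW].
  move=> [s t] Wst.
  have [[U V] [/= nU nV] UVW] : nbhs (s, t) W by exact: open_nbhs_nbhs.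
  have [U' [BU' U's] U'U] := bBS s _ nU.
  have [V' [BV' V't] V'V] := bBT t _ nV.
  exists (U', V'); split => //= -[x y] [/= /U'U Ux /V'V Vy].
  exact: UVW.
rewrite bigcup_set_type.
apply: countable_bigcupT_measurable.
  by rewrite (eq_countable (card_setT D)).
move=> [[U V] /set_mem [[/= BU BV] _]] /=.
apply: measurableX; apply: sub_sigma_algebra; [exact: oBS|exact: oBT].
Qed.

Lemma continuous_measurable_prod (S T Z : ptopologicalType) (f : S * T -> Z) :
  @second_countable S -> @second_countable T -> continuous f ->
  measurable_fun [set: borel S * borel T] (f : borel S * borel T -> borel Z).
Proof.
move=> scS scT /continuousP cf.
apply: (@measurability _ _ _ (borel Z) setT _ (@open Z)) => //.
move=> _ [U oU <-]; rewrite setTI.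
by apply: measurable_open_prod => //; exact: cf.
Qed.

Lemma continuous_measurable (S T : ptopologicalType) (f : S -> T) :
  continuous f -> measurable_fun [set: borel S] (f : borel S -> borel T).
Proof.
move=> /continuousP cf.
apply: (@measurability _ _ (borel S) (borel T) setT _ (@open T)) => //.
move=> _ [U oU <-]; rewrite setTI; apply: sub_sigma_algebra.
exact: cf.
Qed.

Lemma continuous_pair_comp (X S T Z : topologicalType) (F : S * T -> Z)
    (u : X -> S) (v : X -> T) :
  continuous F -> continuous u -> continuous v ->
  continuous (fun x => F (u x, v x)).
Proof.
move=> cF cu cv x.
apply: (@cvg_comp _ _ _ (fun x => (u x, v x)) F _ (nbhs (u x, v x))); last first.
  exact: cF.
by apply: cvg_pair; [exact: cu|exact: cv].
Qed.

(** * Averaging over measure preserving maps *)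

Lemma probability_integral_cst d (T : measurableType d) (R : realType)
    (P : probability T R) (c : \bar R) : \int[P]_x c = c.
Proof.
by rewrite [LHS](integral_cst P measurableT)/= probability_setT mule1.
Qed.

Lemma ge0_integral_preserving d (T : measurableType d) (R : realType)
    (mu : {measure set T -> \bar R}) (phi : T -> T) (f : T -> \bar R) :
  measurable_fun setT phi ->
  (forall A, measurable A -> mu (phi @^-1` A) = mu A) ->
  measurable_fun setT f -> (forall x, 0 <= f x) ->
  \int[mu]_x f (phi x) = \int[mu]_x f x.
Proof.
move=> mphi muphi mf f0.
rewrite -[LHS](@ge0_integral_pushforward _ _ _ _ _ _ mphi mu setT f) //.
by apply: eq_measure_integral => A mA _; exact: muphi.
Qed.

Lemma measurable_average (R : realType) (S T : ptopologicalType)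
    (F : S * T -> T) (mu : probability (borel S) R) (f : borel T -> \bar R) :
  @second_countable S -> @second_countable T -> continuous F ->
  measurable_fun [set: borel T] f -> (forall t, 0 <= f t) ->
  measurable_fun [set: borel T] (fun t => \int[mu]_s f (F (s, t))).
Proof.
move=> scS scT cF mf f0.
have mF := continuous_measurable_prod scS scT cF.
apply: (@measurable_fun_fubini_tonelli_G _ _ (borel S) (borel T) R mu
  (fun p => f (F p))) => //.
exact: measurableT_comp mf mF.
Qed.

(** When each [F (s, _)] preserves [P], the random map obtained from an [s]
    drawn independently preserves [P] too.  For an action this decomposes an
    invariant [P] over the orbits; for a group acting on itself it compares two
    descriptions of Haar measure. *)
Lemma integral_average (R : realType) (S T : ptopologicalType)
    (F : S * T -> T) (mu : probability (borel S) R)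
    (P : probability (borel T) R) (f : borel T -> \bar R) :
  @second_countable S -> @second_countable T -> continuous F ->
  (forall (s : S) (A : set (borel T)), measurable A ->
    P ((fun t => F (s, t)) @^-1` A) = P A) ->
  measurable_fun [set: borel T] f -> (forall t, 0 <= f t) ->
  \int[P]_t f t = \int[P]_t \int[mu]_s f (F (s, t)).
Proof.
move=> scS scT cF FP mf f0.
have mF := continuous_measurable_prod scS scT cF.
have mfF : measurable_fun setT (fun p : borel S * borel T => f (F p)).
  exact: measurableT_comp mf mF.
rewrite -(@fubini_tonelli _ _ _ _ _ mu P _ mfF) //.
under [RHS]eq_integral => s _.
  rewrite (@ge0_integral_preserving _ _ _ P (fun t => F (s, t))) //; first last.
  - exact: FP.
  - exact: (measurableT_comp mF (pair1_measurable s)).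
  over.
exact/esym/probability_integral_cst.
Qed.

(** * Invariance properties of Haar measure *)

Lemma haar_integral_mull (R : realType) (G : topGroupType)
    (mu : probability (borel G) R) (f : borel G -> \bar R) (g : G) :
  is_haar mu -> measurable_fun [set: borel G] f -> (forall h, 0 <= f h) ->
  \int[mu]_h f (g * h)%g = \int[mu]_h f h.
Proof.
move=> muP mf f0.
apply: (@ge0_integral_preserving _ _ _ mu (fun h : borel G => (g * h)%g)) => //.
  apply: continuous_measurable.
  apply: (continuous_pair_comp (u := fun=> g) (v := id) (@mulg_continuous G)).
    exact: cst_continuous.
  by move=> h; exact: cvg_id.
exact: muP.
Qed.

(** Draw [g] and [h] independently with law [mu].  Given [g], left invariance
    says that [g^-1 * h] has law [mu]; given [h], it says that
    [g^-1 * h = (h^-1 * g)^-1] has the law of the inverse of a [mu]-distributed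
    element. *)
Lemma haar_integral_inv (R : realType) (G : topGroupType)
    (mu : probability (borel G) R) (f : borel G -> \bar R) :
  @second_countable G -> is_haar mu ->
  measurable_fun [set: borel G] f -> (forall g, 0 <= f g) ->
  \int[mu]_g f g^-1%g = \int[mu]_g f g.
Proof.
move=> scG muP mf f0.
have cdivl : continuous (fun p : G * G => (p.1^-1 * p.2)%g).
  apply: (continuous_pair_comp (u := fun p => p.1^-1%g) (v := snd)
    (@mulg_continuous G)) => p; last exact: cvg_snd.
  apply: (@cvg_comp _ _ _ fst (fun g : G => g^-1%g) _ (nbhs p.1)).
    exact: cvg_fst.
  exact: invg_continuous.
rewrite [RHS](@integral_average R G G (fun p => (p.1^-1 * p.2)%g) mu) //;
  last first.
  by move=> g A mA; exact: (muP g^-1%g A mA).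
under [RHS]eq_integral => h _.
  have -> : \int[mu]_g f (g^-1 * h)%g = \int[mu]_g f (h^-1 * g)^-1%g.
    by apply: eq_integral => g _; rewrite invgM invgK.
  rewrite (@haar_integral_mull _ _ _ (fun g => f g^-1%g) h^-1%g) //; last first.
    apply: (measurableT_comp mf).
    exact: (continuous_measurable (@invg_continuous G)).
  over.
exact/esym/probability_integral_cst.
Qed.

(** Inversion exchanges left and right translations:
    [h^-1 * g = (g^-1 * h)^-1]. *)
Lemma haar_integral_mulr (R : realType) (G : topGroupType)
    (mu : probability (borel G) R) (f : borel G -> \bar R) (g : G) :
  @second_countable G -> is_haar mu ->
  measurable_fun [set: borel G] f -> (forall h, 0 <= f h) ->
  \int[mu]_h f (h * g)%g = \int[mu]_h f h.
Proof.
move=> scG muP mf f0.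
have minv : measurable_fun [set: borel G] (fun h : borel G => h^-1%g : borel G).
  exact: (continuous_measurable (@invg_continuous G)).
have mmulr : measurable_fun [set: borel G]
    (fun h : borel G => (h * g)%g : borel G).
  apply: continuous_measurable.
  apply: (continuous_pair_comp (u := id) (v := fun=> g) (@mulg_continuous G)).
    by move=> h; exact: cvg_id.
  exact: cst_continuous.
rewrite -(@haar_integral_inv _ _ _ (fun h => f (h * g)%g) scG muP) //; last first.
  exact: measurableT_comp mf mmulr.
rewrite -[RHS](@haar_integral_inv _ _ _ _ scG muP) //.
under eq_integral => h _ do rewrite -[(h^-1 * g)%g]invgK invgM invgK.
rewrite (@haar_integral_mull _ _ _ (fun h => f h^-1%g) g^-1%g muP) //.
exact: measurableT_comp mf minv.
Qed.

(** * Uniform laws on orbits *)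

(** Averaging over the orbit of [y] can start from [y] itself instead of the
    point that [unif] chooses, a choice that need not be measurable in [y]. *)
Lemma unif_orbit_integral (R : realType) (G : topGroupType)
    (Y : ptopologicalType) (a : continuousAction G Y)
    (mu : probability (borel G) R) (f : borel Y -> \bar R) (y : Y) :
  @second_countable G -> is_haar mu ->
  measurable_fun [set: borel Y] f -> (forall y, 0 <= f y) ->
  \int[unif mu a (act_orbit a y)]_z f z = \int[mu]_g f (a g y).
Proof.
move=> scG muP mf f0.
rewrite /unif ge0_integral_distribution //.
(* The representative is [a g y] for some [g], and the action turns the change
   of representative into a right translation by [g]. *)
have [g _ <-] : act_orbit a y (xget point (act_orbit a y)).
  by apply: (xgetPex point); exists y; exists 1%g => //; exact: act1.
under eq_integral => h _ do rewrite /= /orbit_map -actM.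
rewrite (@haar_integral_mulr _ _ _ (fun h => f (a h y)) g) //.
exact: measurableT_comp mf (measurable_orbit_map a y).
Qed.

(** The law of [g Gbar y] is that of [Gbar y], since [g Gbar] has the law of
    [Gbar]. *)
Lemma unif_invariant (R : realType) (G : topGroupType) (Y : ptopologicalType)
    (a : continuousAction G Y) (mu : probability (borel G) R) (O : set Y) :
  is_haar mu -> invariant_probability a (unif mu a O).
Proof.
move=> muP g A mA.
rewrite /unif /distribution /= /pushforward /=.
set y := xget point O.
rewrite -[RHS](muP g); last first.
  by rewrite -[X in measurable X]setTI; exact: measurable_orbit_map.
by congr (mu _); apply/funext => h; rewrite /preimage /= /orbit_map actM.
Qed.

Theorem theorem1 (R : realType) (G : topGroupType) (Y : ptopologicalType)
    (G_lcscH : lcscH G) (G_compact : compact [set: G]) (Y_lcscH : lcscH Y)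
    (a : continuousAction G Y)
    (haar : probability (borel G) R) (haarP : is_haar haar)
    (eps : borel Y -> \bar R) (eps_ge0 : forall y, 0 <= eps y)
    (eps_meas : measurable_fun [set: borel Y] eps) :
  (valid_evalue a eps <->
    (forall O : set Y, act_orbits a O -> \int[unif haar a O]_y eps y <= 1)) /\
  (exact_evalue a eps <->
    (forall O : set Y, act_orbits a O -> \int[unif haar a O]_y eps y = 1)).
Proof.
have [[scG _ _] [scY _ _]] := (G_lcscH, Y_lcscH).
have cact := @act_continuous _ _ a.
have avg (P : probability (borel Y) R) : invariant_probability a P ->
    \int[P]_y eps y = \int[P]_y \int[haar]_g eps (a g y).
  by move=> Pinv; exact: (integral_average haar scG scY cact Pinv).
have orbit y : \int[unif haar a (act_orbit a y)]_z eps z =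
    \int[haar]_g eps (a g y) by exact: unif_orbit_integral.
split; split.
- by move=> valid O _; apply: valid; exact: unif_invariant.
- move=> le1 P Pinv; rewrite (avg P Pinv).
  rewrite -[leRHS](probability_integral_cst P).
  apply: ge0_le_integral => //.
  + by move=> y _; exact: integral_ge0.
  + exact: (measurable_average haar scG scY cact).
  + by move=> y _; rewrite -orbit; apply: le1; exists y.
- by move=> exct O _; apply: exct; exact: unif_invariant.
- move=> eq1 P Pinv; rewrite (avg P Pinv).
  rewrite -[RHS](probability_integral_cst P).
  by apply: eq_integral => y _; rewrite -orbit; apply: eq1; exists y.
Qed.
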